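(* Let $C\in\mathcal{L}(\mathfrak{X})$ be a contraction (i.e. $\|C\|\le 1$) on a Banach space $\mathfrak{X}$. Then $\{e^{t(C-\mathbf{1})}\}_{t\ge 0}$ is a norm-continuous contraction semigroup on $\mathfrak{X}$, and for all $n\in\mathbb{N}$, all $x\in\mathfrak{X}$ and all $\epsilon_n>0$, $$\|(C^n-e^{n(C-\mathbf{1})})x\|\le \frac{n}{\epsilon_n^2}\,2\|x\|+\epsilon_n\,\|(\mathbf{1}-C)x\|.$$ The value of $\epsilon_n>0$ which is optimal (minimizes the right-hand side), for $(\mathbf{1}-C)x\neq 0$, is $$\epsilon_n^*=\left(\frac{4n\|x\|}{\|(\mathbf{1}-C)x\|}\right)^{1/3},$$ and one obtains the estimate $$\|C^n-e^{n(C-\mathbf{1})}\|\le \frac32\,\sqrt[3]{n}\;\|2(\mathbf{1}-C)\|^{2/3},\qquad n\in\mathbb{N}.$$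
   Context: $\mathcal{L}(\mathfrak{X})$ denotes the bounded linear operators on $\mathfrak{X}$, $\mathbf{1}$ is the identity operator, and $\mathbb{N}=\{1,2,\dots\}$. *)

(* Defs.v *)
From HB Require Import structures.
From mathcomp Require Import all_boot all_order all_algebra.
From mathcomp Require Import all_classical all_reals all_analysis.
From mathcomp Require Import complex.

Set Implicit Arguments.
Unset Strict Implicit.
Unset Printing Implicit Defensive.

Import Order.TTheory GRing.Theory Num.Theory.
Import numFieldNormedType.Exports.

Local Open Scope classical_set_scope.
Local Open Scope ring_scope.

(** A Banach space is a [completeNormedModType] over the field [scalar_field R k],
    which is [R] or [R[i]]. *)
Variant scalar_kind := RealScalar | ComplexScalar.

Definition scalar_field (R : realType) (k : scalar_kind) : numFieldType :=
  match k with RealScalar => R | ComplexScalar => R[i] end.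

Definition ofR (R : realType) (k : scalar_kind) : R -> scalar_field R k :=
  match k with RealScalar => id | ComplexScalar => real_complex R end.

Definition toR (R : realType) (k : scalar_kind) : scalar_field R k -> R :=
  match k with RealScalar => id | ComplexScalar => @complex.Re R end.

Section scalar_theory.
Context {R : realType} {k : scalar_kind}.
Implicit Types (a b : R) (z w : scalar_field R k).

Fact ofR_is_zmod_morphism : zmod_morphism (@ofR R k).
Proof. by case: k => // a b; exact: (raddfB (real_complex R)). Qed.

Fact ofR_is_monoid_morphism : monoid_morphism (@ofR R k).
Proof.
by case: k; split=> // a b; exact: (rmorphM (real_complex R)).
Qed.

HB.instance Definition _ :=
  GRing.isZmodMorphism.Build R (scalar_field R k) (@ofR R k) ofR_is_zmod_morphism.
HB.instance Definition _ :=
  GRing.isMonoidMorphism.Build R (scalar_field R k) (@ofR R k) ofR_is_monoid_morphism.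

Lemma ofRK : cancel (@ofR R k) (@toR R k).
Proof. by case: k. Qed.

Lemma ofR_le a b : (ofR k a <= ofR k b) = (a <= b).
Proof. by case: k => //; exact: lecR. Qed.

Lemma norm_ofR a : `|ofR k a| = ofR k `|a|.
Proof.
wlog a0 : a / 0 <= a => [H|].
  have [/H//|/ltW a0] := leP 0 a.
  by rewrite -normrN -[`|a|]normrN -H ?oppr_ge0// rmorphN.
by rewrite !ger0_norm// -(rmorph0 (@ofR R k)) ofR_le.
Qed.

Lemma toRK z : 0 <= z -> ofR k (toR z) = z.
Proof.
case: k z => // z z0.
by rewrite [RHS](complexE z) (ger0_Im z0) rmorph0 mulr0 addr0.
Qed.

End scalar_theory.

(** The norm of a real or complex normed space, as an element of [R]. *)
Definition rnorm (R : realType) (k : scalar_kind)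
  (X : normedModType (scalar_field R k)) (x : X) : R := toR `|x|.

Section rnorm_theory.
Context {R : realType} {k : scalar_kind} {X : normedModType (scalar_field R k)}.
Implicit Types x y : X.

Lemma rnormE x : ofR k (rnorm x) = `|x|.
Proof. exact: toRK. Qed.

Lemma rnorm_ge0 x : 0 <= rnorm x.
Proof. by rewrite -(@ofR_le R k) rnormE rmorph0. Qed.

Lemma rnorm0 : rnorm (0 : X) = 0.
Proof. by rewrite /rnorm normr0 -(rmorph0 (@ofR R k)) ofRK. Qed.

Lemma rnorm0_eq0 x : rnorm x = 0 -> x = 0.
Proof. by move=> x0; apply: normr0_eq0; rewrite -rnormE x0 rmorph0. Qed.

Lemma rnormD x y : rnorm (x + y) <= rnorm x + rnorm y.
Proof. by rewrite -(@ofR_le R k) rmorphD/= !rnormE ler_normD. Qed.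

Lemma rnormZ (a : R) x : rnorm (ofR k a *: x) = `|a| * rnorm x.
Proof.
apply: (can_inj (@ofRK R k)).
by rewrite rmorphM/= !rnormE normrZ norm_ofR.
Qed.

End rnorm_theory.

(** The bounded linear operators on a real or complex normed space [X]. *)
Record bounded_operator (R : realType) (k : scalar_kind)
    (X : normedModType (scalar_field R k)) := BoundedOperator {
  bop_fun :> X -> X ;
  bop_linear : linear bop_fun ;
  bop_bounded : exists M : R, forall x, rnorm (bop_fun x) <= M * rnorm x }.

HB.instance Definition _ (R : realType) (k : scalar_kind)
    (X : normedModType (scalar_field R k)) (A : bounded_operator X) :=
  GRing.isLinear.Build (scalar_field R k) X X *:%R (bop_fun A) (bop_linear A).

Definition opnorm (R : realType) (k : scalar_kind)
    (X : normedModType (scalar_field R k)) (A : bounded_operator X) : R :=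
  sup [set rnorm (A x) | x in [set x : X | rnorm x <= 1]].

Section bounded_operator_algebra.
Context {R : realType} {k : scalar_kind} {X : normedModType (scalar_field R k)}.
Implicit Types A B C : bounded_operator X.

Lemma bopP A B : A =1 B -> A = B.
Proof.
case: A B => [f fl fb] [g gl gb] /= /funext fg.
by case: _ / fg in gl gb *; congr BoundedOperator; exact: Prop_irrelevance.
Qed.

Lemma bop_bounded_ge0 A :
  exists2 M : R, 0 <= M & forall x, rnorm (A x) <= M * rnorm x.
Proof.
have [M AM] := bop_bounded A; exists `|M| => // x.
by rewrite (le_trans (AM x))// ler_wpM2r ?rnorm_ge0 ?ler_norm.
Qed.

HB.instance Definition _ := gen_eqMixin (bounded_operator X).
HB.instance Definition _ := gen_choiceMixin (bounded_operator X).

Program Definition bop_zero := @BoundedOperator R k X (fun=> 0) _ _.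
Next Obligation. by move=> a x y; rewrite scaler0 addr0. Qed.
Next Obligation. by exists 0 => x; rewrite rnorm0 mul0r. Qed.

Program Definition bop_id := @BoundedOperator R k X (fun x => x) _ _.
Next Obligation. by []. Qed.
Next Obligation. by exists 1 => x; rewrite mul1r. Qed.

Program Definition bop_add A B :=
  @BoundedOperator R k X (fun x => A x + B x) _ _.
Next Obligation.
by move=> A B a x y; rewrite !linearP scalerDr addrACA.
Qed.
Next Obligation.
move=> A B; have [[M AM] [N BN]] := (bop_bounded A, bop_bounded B).
exists (M + N) => x.
by rewrite (le_trans (rnormD _ _))// mulrDl lerD.
Qed.

Program Definition bop_comp A B := @BoundedOperator R k X (fun x => A (B x)) _ _.
Next Obligation. by move=> A B a x y; rewrite !linearP. Qed.
Next Obligation.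
move=> A B; have [[M M0 AM] [N BN]] := (bop_bounded_ge0 A, bop_bounded B).
by exists (M * N) => x; rewrite (le_trans (AM _))// -mulrA ler_wpM2l.
Qed.

Program Definition bop_scale (r : R) A :=
  @BoundedOperator R k X (fun x => ofR k r *: A x) _ _.
Next Obligation.
by move=> r A a x y; rewrite linearP scalerDr !scalerA mulrC.
Qed.
Next Obligation.
move=> r A; have [M AM] := bop_bounded A.
by exists (`|r| * M) => x; rewrite rnormZ -mulrA ler_wpM2l.
Qed.

Definition bop_opp := bop_scale (-1).

Fact bop_addA : associative bop_add.
Proof. by move=> A B C; apply: bopP => x /=; rewrite addrA. Qed.
Fact bop_addC : commutative bop_add.
Proof. by move=> A B; apply: bopP => x /=; rewrite addrC. Qed.
Fact bop_add0 : left_id bop_zero bop_add.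
Proof. by move=> A; apply: bopP => x /=; rewrite add0r. Qed.
Fact bop_addN : left_inverse bop_zero bop_opp bop_add.
Proof.
by move=> A; apply: bopP => x /=; rewrite rmorphN rmorph1 scaleN1r addNr.
Qed.

HB.instance Definition _ := GRing.isZmodule.Build (bounded_operator X)
  bop_addA bop_addC bop_add0 bop_addN.

Fact bop_compA : associative bop_comp.
Proof. by move=> A B C; apply: bopP. Qed.
Fact bop_comp1l : left_id bop_id bop_comp.
Proof. by move=> A; apply: bopP. Qed.
Fact bop_comp1r : right_id bop_id bop_comp.
Proof. by move=> A; apply: bopP. Qed.
Fact bop_compDl : left_distributive bop_comp +%R.
Proof. by move=> A B C; apply: bopP. Qed.
Fact bop_compDr : right_distributive bop_comp +%R.
Proof. by move=> A B C; apply: bopP => x; rewrite /= linearD. Qed.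

HB.instance Definition _ := GRing.Zmodule_isPzRing.Build (bounded_operator X)
  bop_compA bop_comp1l bop_comp1r bop_compDl bop_compDr.

Fact bop_scaleA (r s : R) A : bop_scale r (bop_scale s A) = bop_scale (r * s) A.
Proof. by apply: bopP => x /=; rewrite scalerA rmorphM. Qed.
Fact bop_scale1 : left_id 1 bop_scale.
Proof. by move=> A; apply: bopP => x /=; rewrite rmorph1 scale1r. Qed.
Fact bop_scaleDr : right_distributive bop_scale +%R.
Proof. by move=> r A B; apply: bopP => x /=; rewrite scalerDr. Qed.
Fact bop_scaleDl A : {morph bop_scale^~ A : r s / r + s}.
Proof. by move=> r s; apply: bopP => x /=; rewrite rmorphD scalerDl. Qed.

HB.instance Definition _ := GRing.Zmodule_isLmodule.Build R (bounded_operator X)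
  bop_scaleA bop_scale1 bop_scaleDr bop_scaleDl.

Lemma bop0E x : (0 : bounded_operator X) x = 0. Proof. by []. Qed.
Lemma bop1E x : (1 : bounded_operator X) x = x. Proof. by []. Qed.
Lemma bopDE A B x : (A + B) x = A x + B x. Proof. by []. Qed.
Lemma bopME A B x : (A * B) x = A (B x). Proof. by []. Qed.
Lemma bopZE (r : R) A x : (r *: A) x = ofR k r *: A x. Proof. by []. Qed.
Lemma bopNE A x : (- A) x = - A x.
Proof.
by rewrite -[- A]/(bop_opp A) /= rmorphN rmorph1 scaleN1r.
Qed.
Lemma bopBE A B x : (A - B) x = A x - B x.
Proof. by rewrite bopDE bopNE. Qed.

Lemma opnorm_has_sup A :
  has_sup [set rnorm (A x) | x in [set x : X | rnorm x <= 1]].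
Proof.
split; first by exists (rnorm (A 0)), 0 => //=; rewrite rnorm0.
have [M M0 AM] := bop_bounded_ge0 A; exists M => _ [x /= x1 <-].
by rewrite (le_trans (AM x))// ler_piMr.
Qed.

Lemma rnorm_le_opnorm1 A x : rnorm x <= 1 -> rnorm (A x) <= opnorm A.
Proof.
by move=> x1; apply: ub_le_sup; [case: (opnorm_has_sup A)|exists x].
Qed.

Lemma opnorm_le A (M : R) :
  (forall x, rnorm x <= 1 -> rnorm (A x) <= M) -> opnorm A <= M.
Proof.
move=> AM; apply: ge_sup; first by case: (opnorm_has_sup A).
by move=> _ [x /= x1 <-]; exact: AM.
Qed.

Lemma opnorm_ge0 A : 0 <= opnorm A.
Proof.
by rewrite (le_trans (rnorm_ge0 (A 0)))// rnorm_le_opnorm1 ?rnorm0.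
Qed.

Lemma rnorm_le_opnorm A x : rnorm (A x) <= opnorm A * rnorm x.
Proof.
have [x0|x0] := eqVneq (rnorm x) 0.
  by rewrite (rnorm0_eq0 x0) linear0 rnorm0 mulr0.
have {}x0 : 0 < rnorm x by rewrite lt_def x0 rnorm_ge0.
have := @rnorm_le_opnorm1 A (ofR k (rnorm x)^-1 *: x).
rewrite linearZ/= !rnormZ ger0_norm ?invr_ge0 ?rnorm_ge0//.
by rewrite mulVf ?gt_eqF// lexx => /(_ isT); rewrite ler_pdivrMl// mulrC.
Qed.

Fact opnormD A B : opnorm (A + B) <= opnorm A + opnorm B.
Proof.
apply: opnorm_le => x x1; rewrite bopDE (le_trans (rnormD _ _))//.
by rewrite lerD ?rnorm_le_opnorm1.
Qed.

Fact opnormZ (r : R) A : opnorm (r *: A) = `|r| * opnorm A.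
Proof.
have le_opnormZ s B : opnorm (s *: B) <= `|s| * opnorm B.
  by apply: opnorm_le => x x1; rewrite bopZE rnormZ ler_wpM2l ?rnorm_le_opnorm1.
apply/eqP; rewrite eq_le le_opnormZ/=.
have [->|r0] := eqVneq r 0; first by rewrite normr0 mul0r opnorm_ge0.
rewrite -ler_pdivlMl ?normr_gt0// -normfV.
by rewrite (le_trans _ (le_opnormZ _ _))// scalerA mulVf// scale1r.
Qed.

Fact opnorm0_eq0 A : opnorm A = 0 -> A = 0.
Proof.
move=> A0; apply: bopP => x; apply: rnorm0_eq0; apply/le_anti.
by rewrite rnorm_ge0 (le_trans (rnorm_le_opnorm A x))// A0 mul0r lexx.
Qed.

HB.instance Definition _ := Lmodule_isNormed.Build R (bounded_operator X)
  opnormD opnormZ opnorm0_eq0.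

End bounded_operator_algebra.

Notation "''L' ( X )" := (bounded_operator X) (format "''L' ( X )") : type_scope.

(** The limit is taken in operator norm. *)
Definition bop_exp (R : realType) (k : scalar_kind)
    (X : normedModType (scalar_field R k)) (A : 'L(X)) : 'L(X) :=
  lim (series (fun j : nat => (j`!%:R : R)^-1 *: A ^+ j) @ \oo).

(** Only the values of [T] on [[0, +oo[] matter. *)
Definition norm_continuous_contraction_semigroup (R : realType)
    (k : scalar_kind) (X : normedModType (scalar_field R k)) (T : R -> 'L(X)) : Prop :=
  [/\ T 0 = 1,
      forall s t : R, 0 <= s -> 0 <= t -> T (s + t) = T s * T t,
      forall t : R, 0 <= t -> `|T t| <= 1 &
      {within `[0, +oo[, continuous T}].

(* Main.v *)
Require Import Defs.
From HB Require Import structures.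
From mathcomp Require Import all_boot all_order all_algebra.
From mathcomp Require Import all_classical all_reals all_analysis.
From mathcomp Require Import zify ring lra.
Import Order.TTheory GRing.Theory Num.Theory.
Import numFieldNormedType.Exports.
Local Open Scope classical_set_scope.
Local Open Scope ring_scope.

(** Since [1] commutes with [C], the operator [exp (t (C - 1))] is
    [exp (- t) exp (t C) = exp (- t) (\sum_m t ^ m / m! C ^ m)]: the average of
    the powers of [C] for the Poisson distribution of mean [t]. An average of
    contractions is a contraction, and the semigroup law and the norm
    continuity are general properties of the exponential of a bounded operator.

    For [t = n] the difference [C ^ n - exp (n (C - 1))] is therefore the Poisson
    average of [C ^ n - C ^ m]. Applied to [x], this operator costs at most
    [|n - m|] times the norm of [(1 - C) x] by a telescoping sum, and never more
    than twice the norm of [x]. Using the first bound for [|n - m| <= eps] and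
    the second otherwise (lemma [rnorm_subX_tradeoff]), and using that the
    variance of the Poisson distribution equals its mean [n] (lemma
    [poisson_variance_le]), gives the estimate [rnorm_chernoff], as in
    Chebyshev's inequality.

    The right-hand side has the form [a / eps ^ 2 + eps b], with its unique
    minimum at [eps ^ 3 = 2 a / b] (lemma [inv_sqr_add_linear_lt]); inserting
    this value with [a = 2 n] and [b = `|1 - C|] bounds the operator norm.

    The exponential series converges because the operators on a Banach space
    form a Banach space (lemma [bop_cauchy_cvg]). Its multiplicativity on
    commuting operators (lemma [bop_expD]) is deduced from that of the real
    exponential, by domination. *)

(** * Real scalars inside the scalar field *)

Section real_scalars.
Context {R : realType} {k : scalar_kind}.

Lemma ofR_lt (a b : R) : (ofR k a < ofR k b) = (a < b).
Proof. by rewrite !lt_neqAle ofR_le (can_eq ofRK). Qed.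

Lemma ofR_gt0 (a : R) : 0 < a -> 0 < ofR k a.
Proof. by rewrite -ofR_lt rmorph0. Qed.

Lemma toR_gt0 (z : scalar_field R k) : 0 < z -> 0 < toR z.
Proof. by move=> z0; rewrite -(@ofR_lt 0) rmorph0 toRK ?ltW. Qed.

(** A ball of the normed space has a radius in the scalar field; this turns
    membership in it into an inequality between real numbers. *)
Lemma rnorm_lt {X : normedModType (scalar_field R k)} (x : X)
    (z : scalar_field R k) : 0 < z -> (rnorm x < toR z) = (`|x| < z).
Proof. by move=> z0; rewrite -ofR_lt rnormE toRK ?ltW. Qed.

End real_scalars.

(** * The norm of the operator algebra *)

Section operator_norm.
Context {R : realType} {k : scalar_kind} {X : normedModType (scalar_field R k)}.
Implicit Types (A B : 'L(X)) (x : X).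

Lemma bop_scalerAl (a : R) A B : a *: (A * B) = (a *: A) * B.
Proof. exact: bopP. Qed.

Lemma bop_scalerAr (a : R) A B : a *: (A * B) = A * (a *: B).
Proof. by apply: bopP => x; rewrite bopZE !bopME bopZE linearZ. Qed.

Lemma bop_exprZn (a : R) A n : (a *: A) ^+ n = a ^+ n *: A ^+ n.
Proof.
elim: n => [|n IH]; first by rewrite !expr0 scale1r.
by rewrite !exprS IH -bop_scalerAl -bop_scalerAr scalerA.
Qed.

Lemma rnorm_le_norm A x : rnorm (A x) <= `|A| * rnorm x.
Proof. exact: rnorm_le_opnorm. Qed.

Lemma bop_normM A B : `|A * B| <= `|A| * `|B|.
Proof.
apply: opnorm_le => x x1; rewrite bopME (le_trans (rnorm_le_norm _ _))//.
by rewrite ler_wpM2l// rnorm_le_opnorm1.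
Qed.

Lemma bop_norm1 : `|1 : 'L(X)| <= 1.
Proof. exact: opnorm_le. Qed.

Lemma bop_normX A n : `|A ^+ n| <= `|A| ^+ n.
Proof.
elim: n => [|n IH]; first by rewrite !expr0 bop_norm1.
by rewrite !exprS (le_trans (bop_normM _ _))// ler_wpM2l.
Qed.

Lemma rnormN x : rnorm (- x) = rnorm x.
Proof. by rewrite /rnorm normrN. Qed.

Lemma rnorm_sum I (r : seq I) (P : pred I) (f : I -> X) :
  rnorm (\sum_(i <- r | P i) f i) <= \sum_(i <- r | P i) rnorm (f i).
Proof.
elim/big_ind2 : _ => //[|x a y b xa yb]; first by rewrite rnorm0.
by rewrite (le_trans (rnormD _ _))// lerD.
Qed.

(** Closed balls of real radius are closed, also when the scalars are complex
    and the order on them is only partial. *)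
Lemma cvg_rnorm_le T (F : set_system T) (FF : ProperFilter F) (f : T -> X) (l : X)
    (M : R) :
  f @ F --> l -> (\forall t \near F, rnorm (f t) <= M) -> rnorm l <= M.
Proof.
move=> fl fM; apply/ler_addgt0Pr => e e0.
have [t [tM lt]] : exists t, rnorm (f t) <= M /\ rnorm (l - f t) < e.
  apply: (@filter_ex _ F); apply: filterI => //.
  have /cvgrPdist_lt/(_ _ (ofR_gt0 _ e0)) := fl.
  by apply: filterS => t; rewrite -rnorm_lt ?ofR_gt0// ofRK.
by rewrite -[l](subrKC (f t)) (le_trans (rnormD _ _))// lerD// ltW.
Qed.

Lemma bop_cvg_app {T} {F : set_system T} {FF : Filter F} (u : T -> 'L(X)) A x :
  u @ F --> A -> (fun n => u n x) @ F --> A x.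
Proof.
move=> uA; apply/cvgrPdist_lt => e e0.
have x1 : 0 < rnorm x + 1 by rewrite ltr_wpDl ?rnorm_ge0.
have d0 : 0 < toR e / (rnorm x + 1) by rewrite divr_gt0// toR_gt0.
have /cvgrPdist_lt/(_ _ d0) := uA; apply: filterS => n /= Aun.
rewrite -rnorm_lt// -bopBE (le_lt_trans (rnorm_le_norm _ _))//.
rewrite (@le_lt_trans _ _ (toR e / (rnorm x + 1) * rnorm x))//.
  by rewrite ler_wpM2r ?rnorm_ge0 ?ltW.
by rewrite mulrAC ltr_pdivrMr// ltr_pM2l ?toR_gt0// ltrDl.
Qed.

Lemma bop_cvgM {T} {F : set_system T} {FF : Filter F} (u v : T -> 'L(X)) A B :
  u @ F --> A -> v @ F --> B -> (fun n => u n * v n) @ F --> A * B.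
Proof.
move=> uA vB; apply/subr_cvg0/norm_cvg0P.
apply: (@squeeze_cvgr _ _ _ _ (fun=> 0)
  (fun n => `|u n| * `|v n - B| + `|u n - A| * `|B|)); last 2 first.
- exact: cvg_cst.
- rewrite [X in _ --> X](_ : _ = `|A| * `|B - B| + `|A - A| * `|B|).
    by apply: cvgD; apply: cvgM; (try exact: cvg_cst); apply: cvg_norm => //;
      apply: cvgB => //; exact: cvg_cst.
  by rewrite !subrr !normr0 mulr0 mul0r addr0.
near=> n; rewrite normr_ge0/=.
rewrite (_ : u n * v n - A * B = u n * (v n - B) + (u n - A) * B).
  by rewrite (le_trans (ler_normD _ _))// lerD// bop_normM.
by rewrite mulrBr mulrBl addrA subrK.
Unshelve. all: by end_near. Qed.

End operator_norm.

(** * Completeness of the operator algebra *)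

Section operator_completeness.
Context {R : realType} {k : scalar_kind}
  {X : completeNormedModType (scalar_field R k)}.

(** The limit operator is built pointwise in the complete space [X]. The Cauchy
    estimate [`|A - B| <= e] says [rnorm (A x - B x) <= e * rnorm x] for all [x]
    at once, so it survives the limit in [B] and makes the pointwise limit
    bounded as well as a limit in operator norm. *)
Lemma bop_cauchy_cvg (F : set_system 'L(X)) (FF : ProperFilter F) :
  cauchy F -> cvg F.
Proof.
move=> /cauchyP F_ex.
have ball_le (A B : 'L(X)) e : ball A e B ->
    forall x, rnorm (A x - B x) <= e * rnorm x.
  rewrite -ball_normE => /= /ltW ABe x; rewrite -bopBE.
  by rewrite (le_trans (rnorm_le_norm _ _))// ler_wpM2r ?rnorm_ge0.
have cF x : cvg ((fun A : 'L(X) => A x) @ F).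
  apply/cauchy_cvgP/cauchy_exP => e e0.
  (* Adding 1 to the norm spares the case [x = 0]. *)
  pose d := toR e / (rnorm x + 1).
  have x1 : 0 < rnorm x + 1 by rewrite ltr_wpDl ?rnorm_ge0.
  have d0 : 0 < d by rewrite divr_gt0// toR_gt0.
  have [A FA] := F_ex _ d0; exists (A x).
  apply: (@filterS _ F _ _ (fun B : 'L(X) => ball (A x) e (B x)) _ FA) => B.
  move=> /ball_le/(_ x) ABx.
  rewrite /= -ball_normE /= -rnorm_lt// (le_lt_trans ABx)//.
  by rewrite /d mulrAC ltr_pdivrMr// ltr_pM2l ?toR_gt0// ltrDl.
pose f x := lim ((fun A : 'L(X) => A x) @ F).
have fP x : (fun A : 'L(X) => A x) @ F --> f x by exact: cF.
have f_le A e : F (ball A e) -> forall x, rnorm (A x - f x) <= e * rnorm x.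
  move=> FA x; apply: (@cvg_rnorm_le _ _ _ _ F FF (fun B : 'L(X) => A x - B x)).
    by apply: cvgB => //; exact: cvg_cst.
  by apply: filterS FA => B /ball_le.
have f_lin : linear f.
  move=> a x y; apply/esym; apply: cvg_unique (fP _); first exact: norm_hausdorff.
  rewrite (_ : (fun A : 'L(X) => _) = (fun A : 'L(X) => a *: A x + A y));
    last first.
    by apply/funext => A; rewrite linearP.
  by apply: cvgD => //; apply: cvgZr.
have f_bounded : exists M : R, forall x, rnorm (f x) <= M * rnorm x.
  have [A /f_le FA] := F_ex 1 ltr01; exists (`|A| + 1) => x.
  rewrite -[f x](subKr (A x)) (le_trans (rnormD _ _))// rnormN mulrDl.
  by rewrite lerD ?rnorm_le_norm.
pose L := BoundedOperator f_lin f_bounded.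
suff : F --> L by move/cvgP.
apply/cvgrPdist_lt => e e0.
have [A FA] := F_ex _ (divr_gt0 e0 (ltr0n R 3)).
have AL : `|A - L| <= e / 3.
  apply: opnorm_le => x x1; rewrite bopBE (le_trans (f_le _ _ FA x))//.
  by rewrite ler_piMr// divr_ge0// ltW.
apply: filterS FA => B; rewrite -ball_normE /= => AB.
rewrite -[L](subrK A) -addrA (le_lt_trans (ler_normD _ _))// distrC.
rewrite [e in ltRHS](_ : _ = e / 3 + e / 3 * 2); last by field.
by rewrite ler_ltD// (lt_trans AB)//; lra.
Qed.

HB.instance Definition _ := Uniform_isComplete.Build 'L(X) bop_cauchy_cvg.

End operator_completeness.

(** * Cauchy products and scalar exponential series *)

Definition cauchy_product {S : pzRingType} (a b : S ^nat) : S ^nat :=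
  fun m => \sum_(i < m.+1) a (m - i)%N * b i.

(** The error is the sum over the upper right triangle of the square of index
    pairs. It has no cancellation left in it, so that an absolute bound on the
    factors transfers the convergence of one Cauchy product to another. *)
Lemma series_cauchy_product {S : pzRingType} (a b : S ^nat) n :
  series a n * series b n - series (cauchy_product a b) n =
  \sum_(i < n) \sum_(n - i <= j < n) a j * b i.
Proof.
have -> : series (cauchy_product a b) n =
    \sum_(i < n) \sum_(0 <= j < n - i) a j * b i.
  rewrite /series/= big_mkord.
  (* Sum over [i] first, then shift the index of [a] down by [i]. *)
  transitivity (\sum_(m < n) \sum_(i < n | (i < m.+1)%N) a (m - i)%N * b i).
    apply: eq_bigr => m _.
    exact: (big_ord_widen n (fun i => a (m - i)%N * b i)).
  rewrite (exchange_big_dep predT)//=; apply: eq_bigr => i _.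
  rewrite -(big_mkord (fun m => (i < m.+1)%N) (fun m => a (m - i)%N * b i)).
  rewrite (big_cat_nat (n := i))//=; last exact: ltnW.
  rewrite big_nat_cond big1 ?add0r; last by move=> m /andP[]; case: leqP; lia.
  rewrite -{1}[i : nat]add0n big_addn big_nat_cond [RHS]big_nat_cond.
  apply: eq_big => [j|j _]; last by rewrite addnK.
  by rewrite ltnS leq_addl !andbT.
have -> : series a n * series b n = \sum_(i < n) \sum_(0 <= j < n) a j * b i.
  rewrite /series/= (big_mkord predT b) mulr_sumr; apply: eq_bigr => i _.
  by rewrite mulr_suml.
rewrite -sumrB; apply: eq_bigr => i _.
rewrite (big_cat_nat (n := (n - i)%N) (p := n))//= ?leq_subr//.
by rewrite addrAC subrr add0r.
Qed.

Lemma bin_div_fact {R : realType} {m i : nat} : (i <= m)%N ->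
  'C(m, i)%:R / m`!%:R = (m - i)`!%:R^-1 * i`!%:R^-1 :> R.
Proof.
move=> im; rewrite -(bin_fact im) !natrM.
have fact_neq0 (n : nat) : (n`!%:R : R) != 0 by rewrite pnatr_eq0 -lt0n fact_gt0.
have bin_neq0 : ('C(m, i)%:R : R) != 0 by rewrite pnatr_eq0 -lt0n bin_gt0.
by field; rewrite bin_neq0 !fact_neq0.
Qed.

Lemma exp_coeff_cauchy_product {R : realType} (x y : R) :
  exp_coeff (x + y) = cauchy_product (exp_coeff x) (exp_coeff y).
Proof.
apply/funext => m; rewrite /cauchy_product/exp_coeff/= exprDn mulr_suml.
apply: eq_bigr => i _.
rewrite -[_ * _ *+ _]mulr_natr -[LHS]mulrA.
by rewrite (bin_div_fact (ltn_ord i : (i <= m)%N)) mulrACA.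
Qed.

Lemma cvg_series_exp_coeff {R : realType} (x : R) :
  series (exp_coeff x) @ \oo --> expR x.
Proof. exact: is_cvg_series_exp_coeff. Qed.

Lemma series_exp_coeff_le_expR {R : realType} (x : R) n :
  0 <= x -> series (exp_coeff x) n <= expR x.
Proof.
move=> x0; apply: nondecreasing_cvgn_le; last exact: is_cvg_series_exp_coeff.
by apply: nondecreasing_series => m _ _; rewrite exp_coeff_ge0.
Qed.

(** * The exponential of a bounded operator *)

Section exponential.
Context {R : realType} {k : scalar_kind}
  {X : completeNormedModType (scalar_field R k)}.
Implicit Types A B : 'L(X).

Definition bop_exp_coeff A : 'L(X) ^nat := fun j => (j`!%:R : R)^-1 *: A ^+ j.

Lemma norm_bop_exp_coeff A j : `|bop_exp_coeff A j| <= exp_coeff `|A| j.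
Proof.
rewrite /bop_exp_coeff /exp_coeff/= normrZ normfV normr_nat mulrC.
by rewrite ler_wpM2r// bop_normX.
Qed.

Lemma cvg_bop_exp A : series (bop_exp_coeff A) @ \oo --> bop_exp A.
Proof.
apply: normed_cvg; apply: series_le_cvg (is_cvg_series_exp_coeff `|A|) => j.
- exact: normr_ge0.
- exact: exp_coeff_ge0.
- exact: norm_bop_exp_coeff.
Qed.

Lemma bop_exp_coeffD A B : GRing.comm A B ->
  bop_exp_coeff (A + B) = cauchy_product (bop_exp_coeff A) (bop_exp_coeff B).
Proof.
move=> cAB; apply/funext => m; rewrite /cauchy_product /bop_exp_coeff.
rewrite exprDn_comm// scaler_sumr; apply: eq_bigr => i _.
rewrite -bop_scalerAl -bop_scalerAr scalerA -[_ * _ *+ _]scaler_nat scalerA mulrC.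
by rewrite (bin_div_fact (ltn_ord i : (i <= m)%N)).
Qed.

(** Both sides are limits of partial sums, and by [series_cauchy_product] the
    difference of these partial sums is dominated term by term by the same
    difference for the real numbers [`|A|] and [`|B|]. That one tends to
    zero, by the addition formula for the real exponential. *)
Lemma bop_expD A B : GRing.comm A B -> bop_exp (A + B) = bop_exp A * bop_exp B.
Proof.
move=> cAB; apply/esym/subr0_eq.
pose D n : 'L(X) := series (bop_exp_coeff A) n * series (bop_exp_coeff B) n
  - series (bop_exp_coeff (A + B)) n.
pose d n : R := series (exp_coeff `|A|) n * series (exp_coeff `|B|) n
  - series (exp_coeff (`|A| + `|B|)) n.
have D_cvg : D @ \oo --> bop_exp A * bop_exp B - bop_exp (A + B).
  by apply: cvgB (cvg_bop_exp _); apply: bop_cvgM; exact: cvg_bop_exp.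
have d0 : d @ \oo --> 0.
  rewrite -(subrr (expR (`|A| + `|B|))) {1}expRD.
  apply: cvgB; last exact: cvg_series_exp_coeff.
  by apply: cvgM; exact: cvg_series_exp_coeff.
have Dd n : `|D n| <= d n.
  rewrite /D /d bop_exp_coeffD// exp_coeff_cauchy_product !series_cauchy_product.
  rewrite (le_trans (ler_norm_sum _ _ _))//; apply: ler_sum => i _.
  rewrite (le_trans (ler_norm_sum _ _ _))//; apply: ler_sum => j _.
  by rewrite (le_trans (bop_normM _ _))// ler_pM// norm_bop_exp_coeff.
apply: cvg_unique D_cvg _; first exact: norm_hausdorff.
apply/norm_cvg0P; apply: squeeze_cvgr (cvg_cst 0) d0.
by near=> n; rewrite normr_ge0 Dd.
Unshelve. all: by end_near. Qed.

(** The bound on [`|bop_exp A|] and the norm continuity of the semigroup both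
    come from this one. *)
Lemma norm_bop_exp_sub1 A : `|bop_exp A - 1| <= expR `|A| - 1.
Proof.
have S_cvg : (fun n => `|series (bop_exp_coeff A) n.+1 - 1|) @ \oo -->
    `|bop_exp A - 1|.
  apply: cvg_norm; apply: cvgB; last exact: cvg_cst.
  by rewrite (cvg_shiftS (series _)); exact: cvg_bop_exp.
have S_le n : `|series (bop_exp_coeff A) n.+1 - 1| <= expR `|A| - 1.
  have := lerB (series_exp_coeff_le_expR _ n.+1 (normr_ge0 A)) (lexx 1).
  apply: le_trans.
  rewrite /series/= !big_nat_recl//=.
  have -> : bop_exp_coeff A 0 = 1 by rewrite /bop_exp_coeff fact0 invr1 scale1r.
  have -> : exp_coeff `|A| 0 = 1 by rewrite /exp_coeff/= expr0 fact0 divr1.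
  rewrite addrAC subrr add0r addrAC subrr add0r (le_trans (ler_norm_sum _ _ _))//.
  by apply: ler_sum => j _; exact: norm_bop_exp_coeff.
rewrite -(cvg_lim _ S_cvg)//; apply: limr_le; first exact: cvgP S_cvg.
by near=> n; exact: S_le.
Unshelve. all: by end_near. Qed.

Lemma bop_exp_scalar (t : R) : bop_exp (t *: (1 : 'L(X))) = expR t *: (1 : 'L(X)).
Proof.
have : series (bop_exp_coeff (t *: (1 : 'L(X)))) @ \oo -->
    (expR t *: (1 : 'L(X))).
  rewrite (_ : series _ = (fun n => series (exp_coeff t) n *: (1 : 'L(X)))).
    exact: cvgZl (cvg_series_exp_coeff _).
  apply/funext => n; rewrite /series/= scaler_suml; apply: eq_bigr => j _.
  by rewrite /bop_exp_coeff bop_exprZn expr1n scalerA mulrC.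
by move/cvg_lim => <-.
Qed.

Lemma bop_exp0 : bop_exp 0 = 1 :> 'L(X).
Proof. by rewrite -(scale0r (1 : 'L(X))) bop_exp_scalar expR0 scale1r. Qed.

Lemma norm_bop_exp A : `|bop_exp A| <= expR `|A|.
Proof.
rewrite -[bop_exp A](subrK 1) (le_trans (ler_normD _ _))//.
by rewrite -[leRHS](subrK 1) lerD ?norm_bop_exp_sub1 ?bop_norm1.
Qed.

Lemma bop_exp_scaleD A (s t : R) :
  bop_exp ((s + t) *: A) = bop_exp (s *: A) * bop_exp (t *: A).
Proof.
rewrite scalerDl bop_expD// /GRing.comm -!bop_scalerAl -!bop_scalerAr.
by rewrite !scalerA mulrC.
Qed.

(** [exp (s A) - exp (t A) = exp (t A) (exp ((s - t) A) - 1)], which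
    [norm_bop_exp_sub1] makes small. *)
Lemma continuous_bop_exp_scale A : continuous (fun t : R => bop_exp (t *: A)).
Proof.
move=> t; apply/subr_cvg0/norm_cvg0P.
apply: (@squeeze_cvgr _ _ _ _ (fun=> 0)
  (fun s : R => `|bop_exp (t *: A)| * (expR (`|s - t| * `|A|) - 1))).
- near=> s; rewrite normr_ge0/= -[X in bop_exp (X *: A) - _](subrKC t).
  rewrite bop_exp_scaleD -[X in _ - X]mulr1 -mulrBr (le_trans (bop_normM _ _))//.
  by rewrite ler_wpM2l// (le_trans (norm_bop_exp_sub1 _))// normrZ.
- exact: cvg_cst.
- rewrite [X in _ --> X](_ : _ =
      `|bop_exp (t *: A)| * (expR (`|t - t| * `|A|) - 1)).
    apply: cvgM; first exact: cvg_cst.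
    apply: cvgB; last exact: cvg_cst.
    apply: continuous_cvg; first exact: continuous_expR.
    apply: cvgM; last exact: cvg_cst.
    by apply: cvg_norm; apply: cvgB; [exact: cvg_id|exact: cvg_cst].
  by rewrite subrr normr0 mul0r expR0 subrr mulr0.
Unshelve. all: by end_near. Qed.

End exponential.

(** * The variance of the Poisson distribution *)

(** With [p m = x ^ m / m!], the recurrence [(m + 1) p (m + 1) = x p m]
    telescopes the second moment about [x], and the remainder is explicit. *)
Lemma poisson_variance_partial {R : realType} (x : R) N :
  \sum_(0 <= m < N) exp_coeff x m * (m%:R - x) ^+ 2 =
  x * series (exp_coeff x) N + N%:R * (x - N%:R) * exp_coeff x N.
Proof.
elim: N => [|N IH]; first by rewrite /series/= !big_nil mulr0 !mul0r addr0.
have pS : N.+1%:R * exp_coeff x N.+1 = x * exp_coeff x N.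
  rewrite /exp_coeff/= exprS factS natrM.
  have ? : (N`!%:R : R) != 0 by rewrite pnatr_eq0 -lt0n fact_gt0.
  have ? : (N.+1%:R : R) != 0 by rewrite pnatr_eq0.
  by field; apply/andP.
have -> : N.+1%:R * (x - N.+1%:R) * exp_coeff x N.+1 =
    (x - N.+1%:R) * (x * exp_coeff x N) by rewrite -pS [RHS]mulrCA [RHS]mulrA.
rewrite big_nat_recr//= IH seriesSr -natr1; set p := exp_coeff x N.
by rewrite -/p; ring.
Qed.

(** Up to the factor [expR (- x)], the variance of the Poisson distribution of
    mean [x] is at most [x]. The remainder in [poisson_variance_partial] is
    nonpositive beyond [x], and truncating the sum only decreases it. *)
Lemma poisson_variance_le {R : realType} (x : R) N : 0 <= x ->
  \sum_(0 <= m < N) exp_coeff x m * (m%:R - x) ^+ 2 <= x * expR x.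
Proof.
move=> x0; pose M := maxn N (Num.trunc x).+1.
have xM : x <= M%:R.
  by rewrite (le_trans (ltW (truncnS_gt x)))// ler_nat leq_maxr.
apply: (@le_trans _ _ (\sum_(0 <= m < M) exp_coeff x m * (m%:R - x) ^+ 2)).
  rewrite [leRHS](big_cat_nat (n := N))//= ?leq_maxl// lerDl sumr_ge0// => m _.
  by rewrite mulr_ge0 ?exp_coeff_ge0 ?sqr_ge0.
rewrite poisson_variance_partial -[leRHS]addr0 lerD//.
  by rewrite ler_wpM2l// series_exp_coeff_le_expR.
by rewrite mulr_le0_ge0 ?exp_coeff_ge0// mulr_ge0_le0// subr_le0.
Qed.

(** * Contractions *)

Section contraction.
Context {R : realType} {k : scalar_kind}
  {X : completeNormedModType (scalar_field R k)}.
Context {C : 'L(X)} (hC : `|C| <= 1).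

Lemma contraction_normX n : `|C ^+ n| <= 1.
Proof. by rewrite (le_trans (bop_normX _ _))// exprn_ile1. Qed.

Lemma contraction_rnormX n (x : X) : rnorm ((C ^+ n) x) <= rnorm x.
Proof.
rewrite (le_trans (rnorm_le_norm _ _))//.
by rewrite ler_piMl ?rnorm_ge0 ?contraction_normX.
Qed.

Lemma bop_exp_sub1E (t : R) :
  bop_exp (t *: (C - 1)) = expR (- t) *: bop_exp (t *: C).
Proof.
rewrite scalerBr -scaleNr addrC bop_expD ?bop_exp_scalar; last first.
  by rewrite /GRing.comm -!bop_scalerAl -!bop_scalerAr mul1r mulr1 !scalerA mulrC.
by rewrite -bop_scalerAl mul1r.
Qed.

(** The factor [expR (- t)] from [bop_exp_sub1E] absorbs the possible growth
    [expR (t * `|C|)] of [bop_exp (t *: C)]. *)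
Lemma norm_contraction_semigroup (t : R) :
  0 <= t -> `|bop_exp (t *: (C - 1))| <= 1.
Proof.
move=> t0; rewrite bop_exp_sub1E normrZ (ger0_norm (expR_ge0 _)) -(expR0 R).
rewrite -[in leRHS](addNr t) expRD ler_wpM2l ?expR_ge0//.
rewrite (le_trans (norm_bop_exp _))// ler_expR normrZ ger0_norm//.
by rewrite ler_piMr.
Qed.

Lemma contraction_semigroup :
  norm_continuous_contraction_semigroup (fun t : R => bop_exp (t *: (C - 1))).
Proof.
split.
- by rewrite scale0r bop_exp0.
- by move=> s t _ _; exact: bop_exp_scaleD.
- exact: norm_contraction_semigroup.
- by apply: continuous_subspaceT; exact: continuous_bop_exp_scale.
Qed.

(** The [j] steps from [C ^+ m] to [C ^+ (m + j)] each cost at most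
    [rnorm ((1 - C) x)], because powers of [C] are contractions. *)
Lemma rnorm_subX_shift m j (x : X) :
  rnorm ((C ^+ (m + j) - C ^+ m) x) <= j%:R * rnorm ((1 - C) x).
Proof.
elim: j => [|j IH]; first by rewrite addn0 subrr mul0r rnorm0.
rewrite -natr1 mulrDl mul1r -(subrKA (C ^+ (m + j))) bopDE.
rewrite (le_trans (rnormD _ _))// addrC lerD//.
rewrite addnS exprSr -[X in _ - X]mulr1 -mulrBr -opprB mulrN bopNE rnormN bopME.
exact: contraction_rnormX.
Qed.

Lemma rnorm_subX m n (x : X) :
  rnorm ((C ^+ n - C ^+ m) x) <= `|m%:R - n%:R| * rnorm ((1 - C) x).
Proof.
wlog mn : m n / (m <= n)%N => [H|].
  have [/H//|/ltnW /H nm] := leqP m n.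
  by rewrite -opprB bopNE rnormN distrC.
rewrite distrC -natrB// normr_nat -{1}(subnKC mn).
exact: rnorm_subX_shift.
Qed.

(** Chebyshev's inequality before integration: where [m] is within [eps] of [n],
    the bound by the number of steps is at most the second term; elsewhere
    [(m - n) ^ 2 / eps ^ 2] exceeds 1 and the trivial bound [2 * rnorm x] is
    at most the first. *)
Lemma rnorm_subX_tradeoff m n (x : X) (eps : R) : 0 < eps ->
  rnorm ((C ^+ n - C ^+ m) x) <=
  (m%:R - n%:R) ^+ 2 / eps ^+ 2 * (2 * rnorm x) + eps * rnorm ((1 - C) x).
Proof.
move=> e0; have [mn|mn] := leP `|m%:R - n%:R| eps.
  rewrite (le_trans (rnorm_subX m n x))// ler_wpDl//.
    by rewrite mulr_ge0 ?divr_ge0 ?sqr_ge0 ?mulr_ge0 ?rnorm_ge0.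
  by rewrite ler_wpM2r// rnorm_ge0.
rewrite ler_wpDr ?mulr_ge0 ?rnorm_ge0 ?(ltW e0)//.
apply: (@le_trans _ _ (2 * rnorm x)).
  rewrite bopBE (le_trans (rnormD _ _))// rnormN mulrDl mul1r.
  by rewrite lerD ?contraction_rnormX.
rewrite ler_peMl ?mulr_ge0 ?rnorm_ge0// ler_pdivlMr ?exprn_gt0// mul1r.
by rewrite -[leRHS]real_normK ?num_real// lerXn2r ?nnegrE ?(ltW e0) ?(ltW mn).
Qed.

(** [expR n] times the difference is the sum over [m] of the Poisson weights
    [n ^ m / m!] times [C ^ n - C ^ m]; [rnorm_subX_tradeoff] is summed
    against them, the total mass and the variance being known. *)
Lemma rnorm_chernoff n (x : X) (eps : R) : 0 < eps ->
  rnorm ((C ^+ n - bop_exp (n%:R *: (C - 1))) x) <=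
  n%:R / eps ^+ 2 * (2 * rnorm x) + eps * rnorm ((1 - C) x).
Proof.
move=> e0; set a := rnorm x; set b := rnorm ((1 - C) x).
set w := exp_coeff (n%:R : R).
have wE (m : nat) : bop_exp_coeff (n%:R *: C) m = w m *: C ^+ m.
  by rewrite /bop_exp_coeff bop_exprZn scalerA mulrC.
have partial_le N :
    rnorm ((series w N *: C ^+ n - series (bop_exp_coeff (n%:R *: C)) N) x) <=
    expR n%:R * (n%:R / eps ^+ 2 * (2 * a) + eps * b).
  rewrite /series scaler_suml -sumrB.
  have -> : (\sum_(0 <= m < N) (w m *: C ^+ n - bop_exp_coeff (n%:R *: C) m)) x =
      \sum_(0 <= m < N) (w m *: (C ^+ n - C ^+ m)) x.
    rewrite (big_morph (fun A : 'L(X) => A x) (fun A B => bopDE A B x) (bop0E x)).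
    by apply: eq_bigr => m _; rewrite wE scalerBr.
  rewrite (le_trans (rnorm_sum _ _ _ _))//.
  apply: (@le_trans _ _ (\sum_(0 <= m < N)
      (w m * (m%:R - n%:R) ^+ 2 * (2 * a / eps ^+ 2) + w m * (eps * b)))).
    apply: ler_sum => m _; rewrite bopZE rnormZ ger0_norm ?exp_coeff_ge0//.
    rewrite -mulrA -mulrDr ler_wpM2l ?exp_coeff_ge0//.
    by rewrite (le_trans (rnorm_subX_tradeoff m n x _ e0))// mulrAC mulrA.
  rewrite big_split/= -!mulr_suml.
  have a0 : 0 <= 2 * a / eps ^+ 2.
    by rewrite divr_ge0 ?sqr_ge0 ?mulr_ge0 ?rnorm_ge0.
  have b0 : 0 <= eps * b by rewrite mulr_ge0 ?rnorm_ge0// ltW.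
  rewrite (le_trans (lerD (ler_wpM2r a0 (poisson_variance_le _ N (ler0n R n)))
    (ler_wpM2r b0 (series_exp_coeff_le_expR _ N (ler0n R n)))))//.
  by rewrite mulrDr lerD// le_eqVlt; apply/orP; left; apply/eqP; ring.
have -> : C ^+ n - bop_exp (n%:R *: (C - 1)) =
    expR (- n%:R) *: (expR n%:R *: C ^+ n - bop_exp (n%:R *: C)).
  by rewrite bop_exp_sub1E scalerBr scalerA -expRD addNr expR0 scale1r.
rewrite bopZE rnormZ ger0_norm ?expR_ge0// expRN ler_pdivrMl ?expR_gt0//.
set D := fun N => series w N *: C ^+ n - series (bop_exp_coeff (n%:R *: C)) N.
have D_cvg : D @ \oo --> expR n%:R *: C ^+ n - bop_exp (n%:R *: C).
  by apply: cvgB (cvg_bop_exp _); apply: cvgZl; exact: cvg_series_exp_coeff.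
apply: (@cvg_rnorm_le _ _ _ _ _ _ (fun N => D N x)) (bop_cvg_app _ _ _ D_cvg) _.
by near=> N; exact: partial_le.
Unshelve. all: by end_near. Qed.
End contraction.

(** * Optimisation of the estimate *)

Lemma powR_third_expr {R : realType} (a : R) j : 0 <= a ->
  (a `^ (1 / 3)) ^+ j = a `^ (j%:R / 3).
Proof.
by move=> a0; rewrite -powR_mulrn ?powR_ge0// -powRrM mul1r mulrC.
Qed.

Lemma powR_third_cube {R : realType} (a : R) : 0 <= a -> (a `^ (1 / 3)) ^+ 3 = a.
Proof. by move=> a0; rewrite powR_third_expr// divff// powRr1. Qed.

(** The hypothesis on [e0] says that the derivative in [e] vanishes there. The
    excess over the minimum is [b / (2 e ^ 2)] times the cubic
    [e0 ^ 3 + 2 e ^ 3 - 3 e0 e ^ 2], which has a double root at [e0] and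
    equals [(e - e0) ^ 2 (2 e + e0)]. *)
Lemma inv_sqr_add_linear_lt {R : realFieldType} (a b e0 e : R) :
  0 < b -> 0 < e0 -> b * e0 ^+ 3 = 2 * a -> 0 < e -> e != e0 ->
  a / e0 ^+ 2 + e0 * b < a / e ^+ 2 + e * b.
Proof.
move=> b_gt0 e0_gt0 e0E e_gt0 ee0.
have aE : a = b * e0 ^+ 3 / 2 by rewrite e0E mulrAC divff ?mul1r.
have -> : a / e ^+ 2 + e * b = a / e0 ^+ 2 + e0 * b +
    b / (2 * e ^+ 2) * ((e - e0) ^+ 2 * (2 * e + e0)).
  by rewrite aE; field; rewrite !gt_eqF.
have sqr_gt0 : 0 < (e - e0) ^+ 2 by rewrite exprn_even_gt0//= subr_eq0.
rewrite ltrDl mulr_gt0 ?(mulr_gt0 sqr_gt0) ?divr_gt0 ?mulr_gt0 ?exprn_gt0//; lra.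
Qed.

Theorem lemma2p1 (R : realType) (k : scalar_kind)
    (X : completeNormedModType (scalar_field R k)) (C : 'L(X)) (hC : `|C| <= 1) :
  let bound (n : nat) (x : X) (eps : R) : R :=
    n%:R / eps ^+ 2 * (2 * rnorm x) + eps * rnorm ((1 - C) x) in
  let eps_opt (n : nat) (x : X) : R :=
    (4 * n%:R * rnorm x / rnorm ((1 - C) x)) `^ (1 / 3) in
  [/\ norm_continuous_contraction_semigroup
        (fun t : R => bop_exp (t *: (C - 1))),
      forall (n : nat) (x : X) (eps : R), (0 < n)%N -> 0 < eps ->
        rnorm ((C ^+ n - bop_exp (n%:R *: (C - 1))) x) <= bound n x eps,
      forall (n : nat) (x : X), (0 < n)%N -> (1 - C) x != 0 ->
        0 < eps_opt n x /\
        (forall eps : R, 0 < eps -> eps != eps_opt n x ->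
           bound n x (eps_opt n x) < bound n x eps) &
      forall n : nat, (0 < n)%N ->
        `|C ^+ n - bop_exp (n%:R *: (C - 1))|
          <= 3 / 2 * n%:R `^ (1 / 3) * `|2 *: (1 - C)| `^ (2 / 3)].
Proof.
move=> bound eps_opt.
have chernoff n x eps : 0 < eps ->
    rnorm ((C ^+ n - bop_exp (n%:R *: (C - 1))) x) <= bound n x eps.
  exact: rnorm_chernoff.
split.
- exact: contraction_semigroup.
- by move=> n x eps _; exact: chernoff.
- move=> n x n_gt0 Cx0.
  have b_gt0 : 0 < rnorm ((1 - C) x).
    rewrite lt_def rnorm_ge0 andbT; apply: contra_neq Cx0; exact: rnorm0_eq0.
  have x_gt0 : 0 < rnorm x.
    rewrite lt_def rnorm_ge0 andbT; apply: contra_neq Cx0 => /rnorm0_eq0 ->.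
    by rewrite linear0.
  have c_gt0 : 0 < 4 * n%:R * rnorm x / rnorm ((1 - C) x).
    by rewrite divr_gt0// !mulr_gt0// ltr0n.
  have eps_gt0 : 0 < eps_opt n x by exact: powR_gt0.
  split=> // eps e_gt0 e_neq; rewrite /bound ![_ / _ * (2 * _)]mulrAC.
  apply: inv_sqr_add_linear_lt => //; rewrite /eps_opt powR_third_cube ?ltW//.
  by field; rewrite gt_eqF.
- move=> n n_gt0; set B := `|2 *: (1 - C)|.
  have B_ge0 : 0 <= B by exact: normr_ge0.
  have BE : `|1 - C| = B / 2.
    by rewrite /B normrZ ger0_norm// mulrAC divff ?mul1r.
  (* For [C = 1] no finite [eps] is optimal, but both sides vanish. *)
  have [B0|B_neq0] := eqVneq B 0.
    have -> : C = 1.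
      by apply/eqP; rewrite -subr_eq0 -normr_eq0 distrC BE B0 mul0r.
    rewrite expr1n subrr scaler0 bop_exp0 subrr normr0.
    by rewrite !mulr_ge0 ?powR_ge0 ?divr_ge0.
  have B_gt0 : 0 < B by rewrite lt_def B_neq0.
  (* [2 * p / q] is the optimal value [(4 n / `|1 - C|) ^ (1 / 3)] for
     [rnorm x = 1] and [rnorm ((1 - C) x) = `|1 - C|]: being independent of [x],
     it bounds the operator norm. *)
  set p := n%:R `^ (1 / 3); set q := B `^ (1 / 3).
  have p_gt0 : 0 < p by rewrite powR_gt0// ltr0n.
  have q_gt0 : 0 < q by rewrite powR_gt0.
  have eps_gt0 : 0 < 2 * p / q by rewrite divr_gt0 ?mulr_gt0.
  rewrite -powR_third_expr// -/q; apply: opnorm_le => x x1.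
  apply: (le_trans (chernoff n x _ eps_gt0)).
  have Cx1 : rnorm ((1 - C) x) <= B / 2.
    rewrite (le_trans (rnorm_le_norm _ _))// BE ler_piMr// divr_ge0//.
  have -> : 3 / 2 * p * q ^+ 2 =
      n%:R / (2 * p / q) ^+ 2 * 2 + 2 * p / q * (B / 2).
    rewrite -(powR_third_cube B)// -(powR_third_cube n%:R)// -/p -/q.
    by field; rewrite !gt_eqF.
  rewrite /bound lerD// ler_wpM2l ?(ltW eps_gt0)//.
    by rewrite divr_ge0// exprn_ge0// ltW.
  by rewrite ler_piMr.
Qed.
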